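(* Let $q$ be a power of a prime $p$ and let $n=p_1^{e_1}\cdots p_s^{e_s}$, where $p_1,\dots,p_s$ are distinct odd primes different from $p$ and $e_1,\dots,e_s$ are positive integers. Fix a primitive root system $\eta=(\eta_1,\dots,\eta_s)$ modulo $n$. Then the irreducible factorization of $X^n-1$ over $\mathbb{F}_q$ is given by $$X^n-1=\prod_{(y,x)\in\Sigma(n;q)}\left(\sum_{i=0}^{\omega_y}(-1)^{\omega_y-i}\Big(\sum_{\substack{U\subseteq\{0,\dots,\omega_y-1\}\\|U|=\omega_y-i}}\ \prod_{u\in U}\zeta_{p_1^{e_1-y_1-M_{y_1}}\cdots p_s^{e_s-y_s-M_{y_s}}}^{\eta_1^{x_1}\cdots\eta_s^{x_s}q^u}\Big)X^{p_1^{M_{y_1}}\cdots p_s^{M_{y_s}}\cdot i}\right),$$ where, for $j=1,\dots,s$, $m_{y_j}=\min\{e_j-y_j,1\}$, $\omega_y=\mathrm{lcm}(\mathrm{ord}_{p_1^{m_{y_1}}}(q),\dots,\mathrm{ord}_{p_s^{m_{y_s}}}(q))$ and $M_{y_j}=\max\{e_j-y_j-v_{p_j}(q^{\omega_y}-1),0\}$. And the irreducible factorization of $\Phi_n(X)$ over $\mathbb{F}_q$ is given by $$\Phi_n(X)=\prod_{x\in\Sigma^{\ast}(n;q)}\left(\sum_{i=0}^{\omega_0}(-1)^{\omega_0-i}\Big(\sum_{\substack{U\subseteq\{0,\dots,\omega_0-1\}\\|U|=\omega_0-i}}\ \prod_{u\in U}\zeta_{p_1^{e_1-M_1}\cdots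 p_s^{e_s-M_s}}^{\eta_1^{x_1}\cdots\eta_s^{x_s}q^u}\Big)X^{p_1^{M_1}\cdots p_s^{M_s}\cdot i}\right),$$ where $\omega_0=\mathrm{lcm}(\mathrm{ord}_{p_1}(q),\dots,\mathrm{ord}_{p_s}(q))$ and $M_i=\max\{e_i-v_{p_i}(q^{\omega_0}-1),0\}$, $i=1,\dots,s$.
   Context: A compatible family $\{\zeta_N:\gcd(N,q)=1\}$ is fixed, where $\zeta_N$ is a primitive $N$-th root of unity in an algebraic closure of $\mathbb{F}_q$ and $\zeta_N^{N/M}=\zeta_M$ whenever $M\mid N$. $\Phi_n(X)=\prod_{0\le i<n,\ \gcd(i,n)=1}(X-\zeta_n^i)$. ''Irreducible factorization'' means each factor lies in $\mathbb{F}_q[X]$ and is irreducible over $\mathbb{F}_q$. $v_\ell$ is the $\ell$-adic valuation; $\mathrm{ord}_N(q)$ is the multiplicative order, $\mathrm{ord}_1(q)=1$. An $s$-tuple $\eta=(\eta_1,\dots,\eta_s)$ of integers is a primitive root system modulo $p_1^{e_1}\cdots p_s^{e_s}$ if for every $i$: $\eta_i$ is a primitive root modulo $p_i^{d}$ for all $d\ge1$, and $\eta_i\equiv1\pmod{p_j^{e_j}}$ for every $j\ne i$. For $0\le y_i\le e_i$ put $f_{i,y_i}=\mathrm{ord}_{p_i^{e_i-y_i}}(q)$, $g_{i,y_i}=\phi(p_i^{e_i-y_i})/f_{i,y_i}$. $\Sigma(n;q)$ is the set of $2s$-tuples of integers $(y,x)=(y_1,\dots,y_s,x_1,\dots,x_s)$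 with $0\le y_i\le e_i$ and $0\le x_i\le g_{i,y_i}\gcd(\mathrm{lcm}(f_{1,y_1},\dots,f_{i-1,y_{i-1}}),f_{i,y_i})-1$ for all $i$ (for $i=1$ the gcd is understood to be $1$). $\Sigma^{\ast}(n;q)$ is the set of $s$-tuples $x=(x_1,\dots,x_s)$ with $0\le x_i\le g_{i,0}\gcd(\mathrm{lcm}(f_{1,0},\dots,f_{i-1,0}),f_{i,0})-1$ for all $i$ (same convention for $i=1$). *)

(* Defs.v *)
(* MathComp *)
From HB Require Import structures.
From mathcomp Require Import all_boot all_order all_fingroup all_algebra all_field.

Set Implicit Arguments.
Unset Strict Implicit.
Unset Printing Implicit Defensive.

Import GRing.Theory.
Local Open Scope ring_scope.

(* The least d >= 1 with a ^ d = 1 modulo N.  For N > 0 and a coprime to N it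
   exists and is at most totient N <= N; if a is not invertible modulo N > 1,
   no such d exists and the value is the default 0. *)
Definition mulord (N : nat) (a : int) : nat :=
  head 0%N [seq d <- iota 1 N | (a ^+ d == 1 %[mod N%:Z])%Z].

Definition primitive_root_mod (N : nat) (a : int) : Prop :=
  coprimez a N%:Z /\ mulord N a = totient N.

Definition primitive_root_system (s : nat) (ps e : 'I_s -> nat)
    (eta : 'I_s -> int) : Prop :=
  forall i : 'I_s,
    (forall d : nat, (0 < d)%N -> primitive_root_mod (ps i ^ d) (eta i)) /\
    (forall j : 'I_s, j != i -> (eta i = 1 %[mod (ps j ^ e j)%:Z])%Z).

(* As q > 1, coprimality of N to q excludes N = 0. *)
Definition compatible_roots (L : closedFieldType) (q : nat) (zeta : nat -> L)
    : Prop :=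
  (forall N : nat, coprime N q -> N.-primitive_root (zeta N)) /\
  (forall M N : nat, coprime N q -> (M %| N)%N ->
     zeta N ^+ (N %/ M) = zeta M).

Definition algebraic_closure (F : fieldType) (L : closedFieldType)
    (iota : {rmorphism F -> L}) : Prop :=
  forall z : L, algebraicOver iota z.

(* A factorization of P, written over L, whose factors all come from
   irreducible polynomials over F. *)
Definition irreducible_factorization (F L : fieldType)
    (iota : {rmorphism F -> L}) (I : finType) (P : {poly L})
    (fac : I -> {poly L}) : Prop :=
  P = \prod_(k : I) fac k /\
  forall k : I, exists r : {poly F},
    irreducible_poly r /\ fac k = map_poly iota r.

Section Factorization.

Variables (s q : nat) (ps e : 'I_s -> nat).

Definition ford (i : 'I_s) (yi : nat) : nat :=
  mulord (ps i ^ (e i - yi)) q%:Z.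

Definition gind (i : 'I_s) (yi : nat) : nat :=
  (totient (ps i ^ (e i - yi)) %/ ford i yi)%N.

(* The number of values of x_i.  For the first index the lcm is empty, hence
   equal to 1, and so is the gcd. *)
Definition xnum (y : 'I_s -> nat) (i : 'I_s) : nat :=
  (gind i (y i) *
     gcdn (\big[lcmn/1%N]_(j < s | (j < i)%N) ford j (y j)) (ford i (y i)))%N.

(* 'I_k is the set of integers t with 0 <= t <= k - 1, so these dependent finite
   functions are exactly the tuples with the prescribed bounds; an element of
   Sigma is a tuple y together with a tuple x whose bounds depend on y. *)
Definition Sigma : finType :=
  {y : {dffun forall i : 'I_s, 'I_(e i).+1} &
       {dffun forall i : 'I_s, 'I_(xnum (fun j => y j) i)}}.

Definition Sigma_y (yx : Sigma) (i : 'I_s) : nat := tag yx i.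
Definition Sigma_x (yx : Sigma) (i : 'I_s) : nat := tagged yx i.

Definition SigmaStar : finType :=
  {dffun forall i : 'I_s, 'I_(xnum (fun=> 0%N) i)}.

Definition omega (y : 'I_s -> nat) : nat :=
  \big[lcmn/1%N]_(j < s) mulord (ps j ^ minn (e j - y j) 1) q%:Z.

(* Truncated subtraction is max(_, 0). *)
Definition Mexp (y : 'I_s -> nat) (j : 'I_s) : nat :=
  (e j - y j - logn (ps j) (q ^ omega y - 1))%N.

Definition omega0 : nat := \big[lcmn/1%N]_(j < s) mulord (ps j) q%:Z.

Definition Mexp0 (j : 'I_s) : nat :=
  (e j - logn (ps j) (q ^ omega0 - 1))%N.

Variables (L : fieldType) (zeta : nat -> L) (eta : 'I_s -> int).

Definition eta_pow (x : 'I_s -> nat) : int := \prod_(i < s) eta i ^+ x i.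

(* z is the root of unity, a the integer eta^x, w the order and D the exponent
   multiplier of X.  The exponents of z are in int since eta may have negative
   entries. *)
Definition factor_shape (z : L) (a : int) (w D : nat) : {poly L} :=
  \sum_(i < w.+1)
    ((-1) ^+ (w - i) *
       \sum_(U : {set 'I_w} | #|U| == (w - i)%N)
          \prod_(u in U) z ^ (a * (q ^ u)%:Z)) *: 'X^(D * i).

Definition Xn_factor (yx : Sigma) : {poly L} :=
  let y := Sigma_y yx in
  factor_shape (zeta (\prod_(j < s) ps j ^ (e j - y j - Mexp y j))%N)
    (eta_pow (Sigma_x yx)) (omega y) (\prod_(j < s) ps j ^ Mexp y j)%N.

Definition Phi_factor (x : SigmaStar) : {poly L} :=
  factor_shape (zeta (\prod_(j < s) ps j ^ (e j - Mexp0 j))%N)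
    (eta_pow (fun i => x i)) omega0 (\prod_(j < s) ps j ^ Mexp0 j)%N.

End Factorization.

(* Main.v *)
Require Import Defs.
From HB Require Import structures.
From mathcomp Require Import all_boot all_order all_fingroup all_algebra all_field.
From mathcomp Require Import cyclic zify.

Set Implicit Arguments.
Unset Strict Implicit.
Unset Printing Implicit Defensive.

Import GRing.Theory.
Local Open Scope ring_scope.

(* Fix y, let m be the product of the p_i^(e_i - y_i), and let f_i be the order
   of q modulo p_i^(e_i - y_i).  Reading eta^x q^u = eta^x' modulo
   p_1^(e_1 - y_1), p_2^(e_2 - y_2), ... in turn determines x_1, x_2, ... within
   the prescribed bounds, since u is already known to be a multiple of
   lcm(f_1, ..., f_(i-1)) when the i-th coordinate is reached.  As the product
   of the bounds times lcm(f_1, ..., f_s) is phi(m), the eta^x represent the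
   cosets of <q> in (Z/m)^*, so Phi_m is the product over x of the Frobenius orbit
   polynomials of zeta_m^(eta^x), which are irreducible.  Lifting the exponent
   gives lcm(f_1, ..., f_s) = omega_y * D with D the product of the p_i^M_i;
   comparing degrees and roots, each orbit polynomial is the product over
   u < omega_y of X^D - zeta_(m/D)^(eta^x q^u), whose expansion by elementary
   symmetric functions is the stated factor. *)

(** * Congruences between integers and the multiplicative order *)

Lemma eqz_modX (N a b : int) (k : nat) :
  (a = b %[mod N] -> a ^+ k = b ^+ k %[mod N])%Z.
Proof.
move=> ab; elim: k => [//|k IHk].
by rewrite !exprS -modzMm ab IHk modzMm.
Qed.

Lemma PoszX (a k : nat) : (a ^ k)%:Z = a%:Z ^+ k.
Proof. by rewrite -!natz natrX. Qed.

Lemma Euler_expz_totient (N : nat) (a : int) :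
  (0 < N)%N -> coprimez a N -> (a ^+ totient N = 1 %[mod N%:Z])%Z.
Proof.
move=> N_gt0 coaN.
have N_neq0 : N%:Z != 0 by rewrite eqz_nat -lt0n.
have [r def_r] : {r : nat | (a %% N)%Z = r%:Z}.
  by exists `|(a %% N)%Z|%N; rewrite gez0_abs ?modz_ge0.
have corN : coprime r N.
  by rewrite /coprime -eqz_nat -[X in X == _]/(gcdz r%:Z N) -def_r gcdz_modl.
rewrite -(eqz_modX _ (modz_mod a N)) def_r -PoszX.
by rewrite !modz_nat Euler_exp_totient.
Qed.

Lemma totient_leq (N : nat) : (totient N <= N)%N.
Proof.
rewrite totient_count_coprime.
rewrite -[X in (_ <= X)%N]muln1 -[X in (_ <= X * _)%N]subn0.
by rewrite -sum_nat_const_nat leq_sum // => i _; apply: leq_b1.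
Qed.

(** By Euler, [totient N] belongs to the filtered list, so [head] never returns its default 0. The
    list is increasing, so its head is the least exponent, and division with remainder gives the
    divisibility criterion. *)
Lemma mulordP (N : nat) (a : int) : (0 < N)%N -> coprimez a N ->
  (0 < mulord N a)%N /\
  forall k : nat, (a ^+ k == 1 %[mod N%:Z])%Z = (mulord N a %| k)%N.
Proof.
move=> N_gt0 coaN; rewrite /mulord.
set P := fun d : nat => _; set r := filter P _.
have r_tot : totient N \in r.
  rewrite mem_filter mem_iota totient_gt0 N_gt0 add1n ltnS totient_leq !andbT.
  by apply/eqP/Euler_expz_totient.
have r_sorted : sorted ltn r.
  exact/(sorted_filter ltn_trans)/iota_ltn_sorted.
have mem_r d : (d \in r) = [&& P d, 0 < d & d <= N]%N.
  by rewrite mem_filter mem_iota add1n ltnS.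
case: r r_tot r_sorted mem_r => // d0 r _ /= r_sorted mem_r.
have /and3P[/eqP Pd0 d0_gt0 d0_leN] : [&& P d0, 0 < d0 & d0 <= N]%N.
  by rewrite -mem_r mem_head.
split=> // k.
have -> : (a ^+ k == 1 %[mod N%:Z])%Z = P (k %% d0)%N.
  rewrite {1}(divn_eq k d0) exprD mulnC exprM /P -modzMml (eqz_modX _ Pd0).
  by rewrite expr1n modzMml mul1r.
apply/idP/idP => [Pk|/eqP->]; last by rewrite /P expr0.
apply: contraT; rewrite /dvdn -lt0n => k_gt0.
have ltk : (k %% d0 < d0)%N by rewrite ltn_mod.
have := mem_r (k %% d0)%N; rewrite Pk k_gt0 (leq_trans (ltnW ltk)) //.
rewrite inE ltn_eqF //= => /(allP (order_path_min ltn_trans r_sorted)).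
by rewrite ltnNge ltnW.
Qed.

Lemma mulord1 (a : int) : mulord 1 a = 1%N.
Proof. by rewrite /mulord /= !modz1 eqxx. Qed.

(** * Lifting the exponent at an odd prime *)

Lemma modn_sum_expn (p A t : nat) : (A = 1 %[mod p])%N ->
  (\sum_(i < t) A ^ i = t %[mod p])%N.
Proof.
move=> A1; elim: t => [|t IHt]; first by rewrite big_ord0.
by rewrite big_ord_recr /= -modnDm IHt -modnXm A1 modnXm exp1n modnDm addn1.
Qed.

(** Modulo p^2 only the linear term of each (1 + cp)^i survives, and the indices i < t add up to
    C(t, 2). *)
Lemma modn_sqr_sum_expn (p c t : nat) :
  (\sum_(i < t) (1 + c * p) ^ i = t + c * p * 'C(t, 2) %[mod p ^ 2])%N.
Proof.
have powE i : ((1 + c * p) ^ i = 1 + i * (c * p) %[mod p ^ 2])%N.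
  elim: i => [//|i IHi]; rewrite expnS -modnMmr IHi modnMmr.
  rewrite [RHS](_ : _ = (i * c * c * p ^ 2 + (1 + i.+1 * (c * p))) %% p ^ 2)%N.
    by congr (_ %% _)%N; rewrite -mulnn; nia.
  by rewrite modnMDl.
elim: t => [|t IHt]; first by rewrite big_ord0 bin0n muln0.
rewrite big_ord_recr /= -modnDm IHt powE modnDm binS bin1.
by congr (_ %% _)%N; nia.
Qed.

(** Here B^u - 1 is B - 1 times a geometric sum of u terms. Write t = t' p^j with t' prime to p:
    passing to the exponent t' adds nothing to the valuation, as the sum is t' modulo p, and each
    further factor p adds exactly one, as the sum is then p modulo p^2. *)
Lemma logn_expn_sub1 (p A t : nat) : prime p -> odd p -> (1 < A)%N ->
  (p %| A - 1)%N -> (0 < t)%N ->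
  logn p (A ^ t - 1) = (logn p (A - 1) + logn p t)%N.
Proof.
move=> p_prime p_odd A_gt1 pA t_gt0.
have p_gt0 := prime_gt0 p_prime.
have logS B u : (1 < B)%N -> (0 < u)%N ->
    logn p (B ^ u - 1) = (logn p (B - 1) + logn p (\sum_(i < u) B ^ i))%N.
  move=> B_gt1 u_gt0; rewrite !subn1 predn_exp lognM //; first by lia.
  case: u u_gt0 => // u _; rewrite big_ord_recl expn0 add1n //.
have [t' cop ->] := pfactor_coprime p_prime t_gt0.
set j := logn p t.
have t'_gt0 : (0 < t')%N.
  case: (posnP t') cop => // ->; rewrite /coprime gcdn0 => /eqP p1.
  by rewrite p1 in p_prime.
have mod1 B : (1 < B)%N -> (p %| B - 1)%N -> (B = 1 %[mod p])%N.
  by move=> B_gt1 pB; apply/eqP; rewrite eqn_mod_dvd // ltnW.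
have pows u : (0 < u)%N -> (1 < A ^ u)%N /\ (p %| A ^ u - 1)%N.
  move=> u_gt0; split; first by rewrite -(exp1n u) ltn_exp2r.
  by rewrite subn1 predn_exp -subn1 dvdn_mulr.
elim: j => [|j IHj].
  rewrite expn0 muln1 logS // [logn p t'](_ : _ = 0%N); last first.
    by apply/eqP; rewrite lognE p_prime t'_gt0 -if_neg -prime_coprime // cop.
  congr addn; rewrite lognE p_prime /dvdn modn_sum_expn; last exact: mod1.
  rewrite -/(dvdn p t').
  by rewrite -[(p %| t')%N]negbK -prime_coprime // cop andbF.
have [] := pows (t' * p ^ j)%N; first by rewrite muln_gt0 t'_gt0 expn_gt0 p_gt0.
rewrite expnSr mulnA [(A ^ (_ * p))%N]expnM; move: IHj.
set B := (A ^ _)%N => IHj B_gt1 pB; rewrite logS // IHj.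
rewrite [in RHS]lognM ?muln_gt0 ?t'_gt0 ?expn_gt0 ?p_gt0 //.
rewrite -addnA; congr (_ + (_ + _))%N.
rewrite -[p in RHS]expn1 pfactorK //.
have def_B : B = (1 + (B - 1) %/ p * p)%N by rewrite divnK //; lia.
have sumB : (\sum_(i < p) B ^ i = p %[mod p ^ 2])%N.
  (* Oddness enters here: 2 is the only prime p that does not divide C(p, 2). The correction term
     then vanishes modulo p^2. *)
  have /dvdnP[c bin_p] : (p %| 'C(p, 2))%N.
    rewrite prime_dvd_bin //= ltn_neqAle prime_gt1 // andbT.
    by apply: contraTneq p_odd => <-.
  rewrite def_B modn_sqr_sum_expn bin_p -mulnA (mulnCA p) mulnn mulnA addnC.
  by rewrite modnMDl.
have S_gt0 : (0 < \sum_(i < p) B ^ i)%N.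
  by rewrite (bigD1 (Ordinal p_gt0)) //= expn0.
apply/eqP; rewrite eqn_leq -ltnS ltnNge.
rewrite -!pfactor_dvdn // [(p ^ 2 %| _)%N]/dvdn sumB expn1.
rewrite -[(p %% p ^ 2 == 0)%N]/(p ^ 2 %| p)%N.
have -> : (p ^ 2 %| p)%N = false.
  apply/negP => /(dvdn_leq p_gt0).
  by rewrite -mulnn; have := prime_gt1 p_prime; nia.
rewrite /= /dvdn -(modn_dvdm (m:=p^2)) ?dvdn_exp // sumB modn_dvdm ?dvdn_exp //.
by rewrite modnn.
Qed.

(** * The stated factors as products of binomials *)

Lemma factor_shape_prod (q : nat) (L : fieldType) (z : L) (a : int)
    (w D : nat) :
  factor_shape q z a w D =
    \prod_(u < w) ('X^D - (z ^ (a * (q ^ u)%:Z))%:P).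
Proof.
pose c (u : 'I_w) := z ^ (a * (q ^ u)%:Z).
under [RHS]eq_bigr do rewrite addrC.
(* In the expansion [U] collects the factors that contribute their constant term; the [w - #|U|]
   others contribute X^D each, so subsets are grouped by that number. *)
rewrite bigA_distr (partition_big (fun U : {set 'I_w} => inord (w - #|U|)%N)
  (fun _ : 'I_w.+1 => true)) //=.
apply: eq_bigr => i _; rewrite big_distrr scaler_suml /=.
have iw : (i <= w)%N by rewrite -ltnS.
have cardU (U : {set 'I_w}) : (#|U| <= w)%N.
  by rewrite -[X in (_ <= X)%N]card_ord max_card.
apply: eq_big => [U|U /eqP cU].
  rewrite -val_eqE /= inordK ?ltnS ?leq_subr //.
  by move: (nat_of_ord i) #|U| iw (cardU U) => {}i j iw ljw; apply/eqP/eqP; lia.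
rewrite [RHS](bigID (mem U)) /=.
rewrite [X in _ = X * _](eq_bigr (fun u => (- c u)%:P)) => [|u uU]; last first.
  by rewrite uU polyCN.
rewrite [X in _ = _ * X](eq_bigr (fun=> 'X^D)) => [|u /negPf-> //].
rewrite prodr_const -rmorph_prod /= prodrN cU mul_polyC.
congr (_ *: _); rewrite -exprM; congr ('X^(_ * _)).
have := cardC U; rewrite card_ord cU.
by rewrite [#|[predC U]|](_ : _ = #|[pred u | u \notin U]|) //; lia.
Qed.

(** * Frobenius orbits and irreducibility over the finite field *)

Section FrobeniusOrbit.

Variables (p k : nat) (F : finFieldType) (L : closedFieldType).
Variable iota : {rmorphism F -> L}.
Hypotheses (p_prime : prime p) (cardF : #|F| = (p ^ k)%N).

(** X^|F| - X is the product of all X - a with a in F, so its image over L vanishes only at images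
    of elements of F. *)
Lemma fixed_in_image (c : L) : c ^+ #|F| = c -> exists a : F, c = iota a.
Proof.
move=> cF.
have /(congr1 (fun P => (map_poly iota P).[c])) := finField_genPoly F.
rewrite /= rmorphB rmorph_prod /= map_polyXn map_polyX !hornerE cF subrr.
move/esym/eqP; rewrite horner_prod prodf_seq_eq0 => /hasP[a _ /=].
rewrite rmorphB /= map_polyX map_polyC !hornerE subr_eq0 => /eqP->.
by exists a.
Qed.

(** The exponent [#|F|] is a power of the characteristic, which L shares with F; this makes the
    power map additive. *)
Lemma Frobenius_rmorphism :
  exists phi : {rmorphism L -> L}, forall x, phi x = x ^+ #|F|.
Proof.
have chL : [pchar L].-nat #|F|.
  rewrite cardF pnatX pnatE //.
  by rewrite (rmorph_pchar iota) ?(card_finPcharP cardF).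
pose f (x : L) := x ^+ #|F|.
have fB : zmod_morphism f.
  by move=> x y; rewrite /f exprDn_pchar // exprNn_pchar.
have fM : monoid_morphism f.
  by split=> [|x y]; rewrite /f ?expr1n ?exprMn.
pose phi : {rmorphism L -> L} := HB.pack f
  (GRing.isZmodMorphism.Build L L f fB)
  (GRing.isMonoidMorphism.Build L L f fM).
by exists phi.
Qed.

Lemma fixed_poly_in_image (phi : {rmorphism L -> L}) (P : {poly L}) :
  (forall x, phi x = x ^+ #|F|) -> map_poly phi P = P ->
  exists r : {poly F}, P = map_poly iota r.
Proof.
move=> phiE phiP.
pose g (c : L) := odflt 0 [pick a | iota a == c].
exists (\poly_(i < size P) g P`_i); apply/polyP => i.
rewrite coef_map coef_poly /=; case: ltnP => [_|le_i]; last first.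
  by rewrite rmorph0 nth_default.
have : P`_i ^+ #|F| = P`_i by rewrite -{2}phiP coef_map /= phiE.
case/fixed_in_image=> a def_a; rewrite /g; case: pickP => [b /eqP-> //|].
by move/(_ a); rewrite def_a eqxx.
Qed.

(** A nonconstant divisor over F has a root in the orbit. Frobenius fixes its coefficients and so
    sends roots to roots; hence it vanishes at all t distinct points of the orbit and is a multiple
    of the orbit polynomial. *)
Lemma irreducible_Frobenius_orbit (z : L) (t : nat) :
  (0 < t)%N -> z ^+ (#|F| ^ t) = z ->
  {in gtn t &, injective (fun u : nat => z ^+ (#|F| ^ u))} ->
  exists r : {poly F},
    irreducible_poly r /\
    \prod_(u < t) ('X - (z ^+ (#|F| ^ u))%:P) = map_poly iota r.
Proof.
move=> t_gt0 zt z_inj; set P := \prod_(u < t) _.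
have [phi phiE] := Frobenius_rmorphism.
pose rs := [seq z ^+ (#|F| ^ u) | u <- seq.iota 0 t].
have PE : P = \prod_(x <- rs) ('X - x%:P).
  by rewrite big_map -[t in seq.iota 0 t]subn0 -/(index_iota 0 t) big_mkord.
have rs_uniq : uniq rs.
  rewrite map_inj_in_uniq ?iota_uniq // => u v; rewrite !mem_iota /= => ut vt.
  exact: z_inj.
have sizeP : size P = t.+1 by rewrite PE size_prod_XsubC size_map size_iota.
have rootP x : root P x = (x \in rs) by rewrite PE root_prod_XsubC.
have powS u : (z ^+ (#|F| ^ u)) ^+ #|F| = z ^+ (#|F| ^ u.+1).
  by rewrite -exprM expnSr.
have [r Pr] : exists r : {poly F}, P = map_poly iota r.
  apply: (fixed_poly_in_image phiE).
  rewrite rmorph_prod /= /P.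
  case: t t_gt0 zt {z_inj P rs PE rs_uniq sizeP rootP} => // t _ zt.
  (* Frobenius moves each linear factor to the next one and, by [zt], the last to the first. *)
  rewrite big_ord_recr big_ord_recl /= mulrC; congr (_ * _).
    by rewrite rmorphB /= map_polyX map_polyC /= phiE powS zt expn0 expr1.
  by apply: eq_bigr => u _; rewrite rmorphB /= map_polyX map_polyC /= phiE powS.
exists r; split=> //; split=> [|d size_d d_dvd].
  by rewrite -(size_map_poly iota) -Pr sizeP ltnS.
pose d' := map_poly iota d.
have d'P : d' %| P by rewrite Pr dvdp_map.
have [x root_x] : exists x, root d' x.
  by apply/closed_rootP; rewrite size_map_poly.
have root_S y : root d' y -> root d' (y ^+ #|F|).
  move=> root_y; rewrite -phiE; have -> : d' = map_poly phi d'.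
    rewrite -map_poly_comp; apply: eq_map_poly => a /=.
    by rewrite phiE -rmorphXn /= expf_card.
  by rewrite rmorph_root.
have root_pow j y : root d' y -> root d' (y ^+ (#|F| ^ j)).
  elim: j => [|j IHj] root_y; first by rewrite expn0 expr1.
  by rewrite expnSr exprM root_S ?IHj.
have /mapP[u] : x \in rs by rewrite -rootP (root_dvdp d'P).
rewrite mem_iota /= => ut def_x.
have root_z : root d' z.
  (* From the u-th point of the orbit, t - u further steps lead back to z. *)
  have := root_pow (t - u)%N _ root_x.
  by rewrite def_x -exprM -expnD subnKC ?zt // ltnW.
have P_d' : P %| d'.
  rewrite PE uniq_roots_dvdp ?uniq_rootsE //; apply/allP => y /mapP[v _ ->].
  exact: root_pow.
by rewrite /eqp d_dvd -(dvdp_map iota) -Pr.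
Qed.

End FrobeniusOrbit.

(** * Integer powers of a primitive root of unity *)

Section PrimitiveRootPowers.

Variables (L : fieldType) (N : nat) (z : L).
Hypothesis prim_z : N.-primitive_root z.

Lemma prim_exprz_mod (a : int) : z ^ a = z ^+ `|(a %% N)%Z|.
Proof.
have z_neq0 : z != 0.
  apply/eqP => z0; have := prim_expr_order prim_z.
  rewrite z0 expr0n gtn_eqF ?(prim_order_gt0 prim_z) // => /esym/eqP.
  by rewrite oner_eq0.
have N_neq0 : N%:Z != 0 by rewrite eqz_nat -lt0n (prim_order_gt0 prim_z).
rewrite {1}(divz_eq a N) expfzDr // mulrC [(_ %/ _)%Z * _]mulrC -exprz_exp.
rewrite -exprnP (prim_expr_order prim_z) exp1rz mulr1.
by rewrite exprnP gez0_abs ?modz_ge0.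
Qed.

Lemma prim_exprz_eq (a b : int) : (z ^ a == z ^ b) = (a == b %[mod N%:Z])%Z.
Proof.
have N_neq0 : N%:Z != 0 by rewrite eqz_nat -lt0n (prim_order_gt0 prim_z).
have lt_mod c : (`|(c %% N)%Z| < N)%N.
  rewrite -ltz_nat gez0_abs ?modz_ge0 // ltz_pmod // ltz_nat.
  exact: prim_order_gt0 prim_z.
rewrite !prim_exprz_mod (eq_prim_root_expr prim_z) !modn_small //.
by rewrite -eqz_nat !gez0_abs ?modz_ge0.
Qed.

Lemma prim_root_exprz (a : int) : coprimez a N -> N.-primitive_root (z ^ a).
Proof.
move=> co_a; rewrite prim_exprz_mod prim_root_exp_coprime //.
rewrite -[N in coprime _ N]absz_nat -coprimezE.
by rewrite /coprimez gcdz_modl.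
Qed.

End PrimitiveRootPowers.

(** * Orders and products of coprime moduli *)

Lemma eqz_expr_mulord (N : nat) (a : int) (i j : nat) :
  (0 < N)%N -> coprimez a N ->
  (a ^+ i == a ^+ j %[mod N%:Z])%Z = (i == j %[mod mulord N a])%N.
Proof.
move=> N_gt0 coaN; have [_ ordP] := mulordP N_gt0 coaN.
wlog le_ij : i j / (i <= j)%N => [hw|].
  by case/orP: (leq_total i j) => /hw // E; rewrite eq_sym E eq_sym.
rewrite [RHS]eq_sym eqn_mod_dvd // -ordP eq_sym -{1}(subnKC le_ij) exprD.
rewrite !eqz_mod_dvd -{2}[a ^+ i]mulr1 -mulrBr Gauss_dvdzr //.
by rewrite coprimez_sym coprimezXl.
Qed.

Lemma coprime_prodr (I : eqType) (r : seq I) (P : I -> nat) (N : nat) :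
  {in r, forall i, coprime N (P i)} -> coprime N (\prod_(i <- r) P i)%N.
Proof.
move=> coP; rewrite big_seq; apply: (big_ind (coprime N)) => //.
- exact: coprimen1.
- by move=> a b coa cob; rewrite coprimeMr coa.
Qed.

Lemma dvdn_prod_coprime (I : eqType) (r : seq I) (P : I -> nat) (N : nat) :
  uniq r -> {in r &, forall i j, i != j -> coprime (P i) (P j)} ->
  (\prod_(i <- r) P i %| N)%N = all (fun i => (P i %| N)%N) r.
Proof.
elim: r => [|i r IHr] /=; first by rewrite big_nil dvd1n.
case/andP=> i_r uniq_r coP; rewrite big_cons Gauss_dvd ?IHr //.
- by move=> j k j_r k_r; apply: coP; rewrite inE ?j_r ?k_r orbT.
- apply: coprime_prodr => j j_r; apply: coP; rewrite ?inE ?eqxx ?j_r ?orbT //.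
  by apply: contraNneq i_r => ->.
Qed.

Lemma totient_prod_coprime (I : eqType) (r : seq I) (P : I -> nat) :
  uniq r -> {in r &, forall i j, i != j -> coprime (P i) (P j)} ->
  totient (\prod_(i <- r) P i) = (\prod_(i <- r) totient (P i))%N.
Proof.
elim: r => [|i r IHr] /=; first by rewrite !big_nil.
case/andP=> i_r uniq_r coP; rewrite !big_cons totient_coprime ?IHr //.
- by move=> j k j_r k_r; apply: coP; rewrite inE ?j_r ?k_r orbT.
- apply: coprime_prodr => j j_r; apply: coP; rewrite ?inE ?eqxx ?j_r ?orbT //.
  by apply: contraNneq i_r => ->.
Qed.

(* Telescoping of [gcd(a, b) * lcm(a, b) = a * b]. *)
Lemma prod_gcd_lcm (s : nat) (f g : 'I_s -> nat) :
  (\prod_(i < s) (g i * gcdn (\big[lcmn/1]_(j < s | (j < i)%N) f j) (f i))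
     * \big[lcmn/1]_(i < s) f i)%N = (\prod_(i < s) (g i * f i))%N.
Proof.
elim: s f g => [|s IHs] f g; first by rewrite !big_ord0.
pose w := widen_ord (leqnSn s).
rewrite !big_ord_recr /= -(IHs (fun i => f (w i)) (fun i => g (w i))) /=.
have -> : \big[lcmn/1%N]_(j < s.+1 | (j < s)%N) f j =
          \big[lcmn/1%N]_(j < s) f (w j).
  rewrite big_mkcond big_ord_recr /= ltnn lcmn1.
  by apply: eq_bigr => j _; rewrite ltn_ord.
have E (i : 'I_s) : \big[lcmn/1%N]_(j < s.+1 | (j < i)%N) f j =
          \big[lcmn/1%N]_(j < s | (j < i)%N) f (w j).
  rewrite big_mkcond big_ord_recr /= ltnNge (ltnW (ltn_ord i)) /= lcmn1.
  by rewrite -big_mkcond.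
under eq_bigr do rewrite E.
set A := \prod_(i < s) _; set l := \big[lcmn/1%N]_(j < s) _.
rewrite -!mulnA; congr muln.
by rewrite [RHS]mulnCA [X in (_ * X)%N = _]mulnC muln_lcm_gcd.
Qed.

(** * Tuples as representatives of the cosets of the powers of q *)

Section Tuples.

Variables (s q : nat) (ps e : 'I_s -> nat) (eta : 'I_s -> int).
Variable y : 'I_s -> nat.
Hypothesis q_gt1 : (1 < q)%N.
Hypothesis ps_prime : forall i, prime (ps i).
Hypothesis ps_odd : forall i, odd (ps i).
Hypothesis ps_coprime : forall i, coprime q (ps i).
Hypothesis ps_distinct : injective ps.
Hypothesis eta_system : primitive_root_system ps e eta.

Definition ppart (i : 'I_s) : nat := (ps i ^ (e i - y i))%N.
Definition modulus : nat := (\prod_(i < s) ppart i)%N.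
(** By the Chinese remainder theorem this is the order of q modulo [modulus]. *)
Definition period : nat := \big[lcmn/1%N]_(i < s) ford q ps e i (y i).
Definition xdeg : nat := (\prod_(i < s) ps i ^ Mexp q ps e y i)%N.

Lemma ppart_gt0 i : (0 < ppart i)%N.
Proof. by rewrite expn_gt0 prime_gt0. Qed.

Lemma coprime_ps_pow i j (a b : nat) :
  i != j -> coprime (ps i ^ a) (ps j ^ b).
Proof.
move=> ij; rewrite coprimeXl ?coprimeXr // prime_coprime // dvdn_prime2 //.
by rewrite (inj_eq ps_distinct).
Qed.

Lemma coprime_q_ppart i : coprimez q%:Z (ppart i)%:Z.
Proof. by rewrite coprimezE !absz_nat coprimeXr. Qed.

Lemma fordP i k :
  (q%:Z ^+ k == 1 %[mod (ppart i)%:Z])%Z = (ford q ps e i (y i) %| k)%N.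
Proof. exact: (mulordP (ppart_gt0 i) (coprime_q_ppart i)).2. Qed.

Lemma ford_gt0 i : (0 < ford q ps e i (y i))%N.
Proof. exact: (mulordP (ppart_gt0 i) (coprime_q_ppart i)).1. Qed.

Lemma period_gt0 : (0 < period)%N.
Proof.
apply: (big_ind (fun a => 0 < a)%N) => // [a b a_gt0 b_gt0|i _].
  by rewrite lcmn_gt0 a_gt0.
exact: ford_gt0.
Qed.

(** For y_i = e_i the modulus is 1, a case outside the definition of a primitive root system, which
    only speaks of d >= 1; there the order and the totient are both 1. *)
Lemma eta_ppart i :
  coprimez (eta i) (ppart i) /\ mulord (ppart i) (eta i) = totient (ppart i).
Proof.
have [prim_i _] := eta_system i.
case: (posnP (e i - y i)%N) => [d0|d_gt0]; last exact: prim_i.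
by rewrite /ppart d0 expn0 mulord1 /coprimez /gcdz gcdn1.
Qed.

Lemma eqz_mod_modulus (a b : int) :
  (a == b %[mod modulus%:Z])%Z =
  [forall i : 'I_s, (a == b %[mod (ppart i)%:Z])%Z].
Proof.
rewrite eqz_mod_dvd dvdzE absz_nat.
rewrite /modulus dvdn_prod_coprime ?index_enum_uniq //.
  apply/allP/forallP => [dv i|dv i _].
    by rewrite eqz_mod_dvd dvdzE dv ?mem_index_enum.
  by have := dv i; rewrite eqz_mod_dvd dvdzE.
by move=> i j _ _; apply: coprime_ps_pow.
Qed.

(** Each eta_j with j different from i is 1 modulo p_i^e_i, hence modulo its divisor p_i^(e_i -
    y_i), so only the i-th factor survives. *)
Lemma eta_pow_ppart (x : 'I_s -> nat) i :
  (eta_pow eta x = eta i ^+ x i %[mod (ppart i)%:Z])%Z.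
Proof.
rewrite /eta_pow (bigD1 i) //= -modzMmr.
suff -> : ((\prod_(j < s | j != i) eta j ^ x j) = 1 %[mod (ppart i)%:Z])%Z.
  by rewrite modzMmr mulr1.
pose eq1 (a : int) : Prop := (a = 1 %[mod (ppart i)%:Z])%Z.
apply: (big_ind eq1) => [//|a b a1 b1|j ji]; rewrite /eq1.
  by rewrite -modzMm a1 b1 modzMm mulr1.
rewrite -exprnP -[1](expr1n _ (x j)); apply: eqz_modX.
have ij : i != j by rewrite eq_sym.
have /eqP := (eta_system j).2 i ij.
rewrite eqz_mod_dvd => dv; apply/eqP; rewrite eqz_mod_dvd; apply: dvdz_trans dv.
by rewrite dvdzE !absz_nat dvdn_exp2l ?leq_subr.
Qed.

Lemma coprime_eta_pow (x : 'I_s -> nat) : coprimez (eta_pow eta x) modulus.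
Proof.
rewrite coprimezE absz_nat; apply: coprime_prodr => i _.
have [co_i _] := eta_ppart i.
suff : coprimez (eta_pow eta x) (ppart i) by rewrite coprimezE absz_nat.
by rewrite /coprimez -gcdz_modl eta_pow_ppart gcdz_modl [_ == _]coprimezXl.
Qed.

(** Since g_i f_i = phi(p_i^(e_i - y_i)), the telescoped product is phi(m): there are as many tuples
    x as cosets of the subgroup generated by q. *)
Lemma xnum_period :
  (\prod_(i < s) xnum q ps e y i * period)%N = totient modulus.
Proof.
rewrite /xnum prod_gcd_lcm /modulus totient_prod_coprime ?index_enum_uniq //.
  apply: eq_bigr => i _; rewrite /gind divnK // -fordP.
  by apply/eqP/Euler_expz_totient; [exact: ppart_gt0 | exact: coprime_q_ppart].
by move=> i j _ _; apply: coprime_ps_pow.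
Qed.

(* Raising the congruence to the power [f_i / gcd h f_i] kills [q ^ u]. *)
Lemma coord_inj (i : 'I_s) (h u x x' : nat) :
  (h %| u)%N -> (eta i ^+ x * q%:Z ^+ u == eta i ^+ x' %[mod (ppart i)%:Z])%Z ->
  x = x' %[mod gind q ps e i (y i) * gcdn h (ford q ps e i (y i))].
Proof.
set f := ford q ps e i (y i); set G := gcdn h f => hu E.
have f_gt0 : (0 < f)%N by apply: ford_gt0.
have G_gt0 : (0 < G)%N by rewrite gcdn_gt0 f_gt0 orbT.
pose c := (f %/ G)%N; have fE : f = (c * G)%N by rewrite divnK ?dvdn_gcdr.
have c_gt0 : (0 < c)%N by move: f_gt0; rewrite fE muln_gt0 => /andP[].
have [co_i ord_i] := eta_ppart i.
have totE : totient (ppart i) = (gind q ps e i (y i) * G * c)%N.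
  rewrite -mulnA [(G * c)%N]mulnC -fE /gind divnK // -fordP.
  by apply/eqP/Euler_expz_totient; [exact: ppart_gt0 | exact: coprime_q_ppart].
have q1 : (q%:Z ^+ (u * c) = 1 %[mod (ppart i)%:Z])%Z.
  apply/eqP; rewrite fordP -/f fE mulnC dvdn_pmul2r //.
  by apply: dvdn_trans hu; apply: dvdn_gcdl.
have : (eta i ^+ (x * c) == eta i ^+ (x' * c) %[mod (ppart i)%:Z])%Z.
  rewrite [eta i ^+ (x' * c)]exprM -(eqz_modX c (eqP E)) exprMn -!exprM.
  by rewrite -modzMmr q1 modzMmr mulr1.
rewrite eqz_expr_mulord ?ppart_gt0 // ord_i totE -!muln_modl eqn_pmul2r //.
by move/eqP.
Qed.

(** The induction carries x_j = x'_j together with f_j | u, because the latter makes the bound on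
    the next coordinate sufficient to determine it. *)
Lemma box_inj_aux (x x' : 'I_s -> nat) (u : nat) :
  (forall i, x i < xnum q ps e y i)%N -> (forall i, x' i < xnum q ps e y i)%N ->
  (eta_pow eta x * q%:Z ^+ u == eta_pow eta x' %[mod modulus%:Z])%Z ->
  (forall i, x i = x' i) /\ (period %| u)%N.
Proof.
move=> bx bx'; rewrite eqz_mod_modulus => /forallP E.
have Ei i : (eta i ^+ x i * q%:Z ^+ u == eta i ^+ x' i %[mod (ppart i)%:Z])%Z.
  by have := E i; rewrite -modzMml !eta_pow_ppart modzMml.
suff coord i : x i = x' i /\ (ford q ps e i (y i) %| u)%N.
  split=> [i|]; first by case: (coord i).
  by apply/dvdn_biglcmP => i _; case: (coord i).
have [N] := ubnP (val i); elim: N i => // N IHN i ltiN.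
have hu : (\big[lcmn/1%N]_(j < s | (j < i)%N) ford q ps e j (y j) %| u)%N.
  apply/dvdn_biglcmP => j ltji; case: (IHN j) => //.
  by apply: leq_trans ltji _.
have xx' : x i = x' i.
  have := coord_inj hu (Ei i); rewrite -/(xnum q ps e y i).
  by rewrite !modn_small ?bx ?bx'.
(* With x_i = x'_i the unit eta_i^(x_i) cancels, leaving q^u = 1 modulo p_i^(e_i - y_i). *)
split=> //; rewrite -fordP; have := Ei i; rewrite xx' !eqz_mod_dvd.
rewrite -{2}[eta i ^+ _]mulr1 -mulrBr Gauss_dvdzr //.
by rewrite coprimez_sym coprimezXl // (eta_ppart i).1.
Qed.

Lemma box_inj (x x' : 'I_s -> nat) (u v : nat) :
  (forall i, x i < xnum q ps e y i)%N -> (forall i, x' i < xnum q ps e y i)%N ->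
  (u < period)%N -> (v < period)%N ->
  (eta_pow eta x * (q ^ u)%:Z == eta_pow eta x' * (q ^ v)%:Z
     %[mod modulus%:Z])%Z ->
  (forall i, x i = x' i) /\ u = v.
Proof.
wlog le_vu : x x' u v / (v <= u)%N => [hw bx bx' up vp E|].
  case/orP: (leq_total v u) => le_uv; first exact: hw.
  rewrite eq_sym in E; have [xx' ->] := hw _ _ _ _ le_uv bx' bx vp up E.
  by split=> // i; rewrite xx'.
move=> bx bx' up vp; rewrite !PoszX -{1}(subnKC le_vu) exprD => E.
(* Cancelling q^v leaves the single exponent u - v. It is below [period] and divisible by it, hence
   0. *)
have [|xx' dvd_uv] := @box_inj_aux x x' (u - v)%N bx bx'.
  move: E; rewrite !eqz_mod_dvd mulrCA [eta_pow eta x' * _]mulrC -mulrBr.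
  rewrite Gauss_dvdzr // coprimez_sym coprimezXl // coprimezE !absz_nat.
  by apply: coprime_prodr => i _; rewrite coprimeXr.
split=> //; case: (posnP (u - v)%N) => [uv0|uv_gt0]; first lia.
by have := dvdn_leq uv_gt0 dvd_uv; lia.
Qed.

(** * The period as [omega] times the exponent multiplier *)

Lemma mulord_ps_dvd i (a k : nat) :
  (mulord (ps i ^ a) q%:Z %| k)%N = (ps i ^ a %| q ^ k - 1)%N.
Proof.
have pa_gt0 : (0 < ps i ^ a)%N by rewrite expn_gt0 prime_gt0.
have [|_ <-] := @mulordP (ps i ^ a) q%:Z pa_gt0.
  by rewrite coprimezE !absz_nat coprimeXr.
by rewrite -PoszX eqz_mod_dvd subzn ?expn_gt0 ?(ltnW q_gt1).
Qed.

Lemma omega_gt0 : (0 < omega q ps e y)%N.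
Proof.
apply: (big_ind (fun a => 0 < a)%N) => // [a b a_gt0 b_gt0|i _].
  by rewrite lcmn_gt0 a_gt0.
apply: (mulordP _ _).1; first by rewrite expn_gt0 prime_gt0.
by rewrite coprimezE !absz_nat coprimeXr.
Qed.

Lemma ps_dvd_omega i : (0 < e i - y i)%N -> (ps i %| q ^ omega q ps e y - 1)%N.
Proof.
move=> d_gt0; rewrite -[ps i]expn1 -mulord_ps_dvd (biglcmn_sup i) //.
by rewrite (minn_idPr d_gt0).
Qed.

Lemma q_omega_gt1 : (1 < q ^ omega q ps e y)%N.
Proof. by rewrite -(expn0 q) ltn_exp2l ?omega_gt0. Qed.

(** If y_i < e_i, lifting the exponent applies to A = q^omega, as p_i divides A - 1: the valuation
    of A^t - 1 exceeds that of A - 1 by that of t, and [Mexp] is what A - 1 falls short of. *)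
Lemma ppart_dvd_omega i (t : nat) : (0 < t)%N ->
  (ppart i %| q ^ (omega q ps e y * t) - 1)%N = (ps i ^ Mexp q ps e y i %| t)%N.
Proof.
move=> t_gt0; rewrite /ppart /Mexp.
case: (posnP (e i - y i)%N) => [->|d_gt0]; first by rewrite sub0n !dvd1n.
have A_gt1 := q_omega_gt1.
have At_gt1 : (1 < q ^ (omega q ps e y * t))%N.
  by rewrite expnM -(exp1n t) ltn_exp2r.
rewrite !pfactor_dvdn ?subn_gt0 // expnM logn_expn_sub1 ?ps_dvd_omega //.
by rewrite [RHS]leq_subLR.
Qed.

(** [omega] divides [period], and f_i divides omega t, for t > 0, exactly when p_i^(M_i) divides t;
    the least such t for all i is [xdeg]. *)
Lemma period_omega : period = (omega q ps e y * xdeg)%N.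
Proof.
have xdeg_gt0 : (0 < xdeg)%N.
  by apply: prodn_gt0 => i; rewrite expn_gt0 prime_gt0.
apply/eqP; rewrite eqn_dvd; apply/andP; split.
  apply/dvdn_biglcmP => i _.
  rewrite mulord_ps_dvd -/(ppart i) ppart_dvd_omega //.
  by rewrite /xdeg (bigD1 i) //= dvdn_mulr.
have /dvdnP[t period_t] : (omega q ps e y %| period)%N.
  apply/dvdn_biglcmP => i _; rewrite mulord_ps_dvd.
  apply: (@dvdn_trans (ppart i)); first by rewrite dvdn_exp2l ?geq_minl.
  by rewrite -mulord_ps_dvd (biglcmn_sup i).
rewrite mulnC in period_t.
have t_gt0 : (0 < t)%N.
  by have := period_gt0; rewrite period_t muln_gt0 => /andP[].
rewrite [X in (_ %| X)%N]period_t dvdn_pmul2l ?omega_gt0 //.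
rewrite dvdn_prod_coprime ?index_enum_uniq //.
  apply/allP => i _; rewrite -ppart_dvd_omega // -period_t -mulord_ps_dvd.
  by rewrite (biglcmn_sup i).
by move=> i j _ _; apply: coprime_ps_pow.
Qed.

(** This makes the powers zeta_(m/D)^(a q^u) depend only on u modulo [omega]. *)
Lemma reduced_modulus_dvd :
  (\prod_(i < s) ps i ^ (e i - y i - Mexp q ps e y i)
     %| q ^ omega q ps e y - 1)%N.
Proof.
rewrite dvdn_prod_coprime ?index_enum_uniq //; last first.
  by move=> i j _ _; apply: coprime_ps_pow.
apply/allP => i _; rewrite pfactor_dvdn ?subn_gt0 ?q_omega_gt1 // /Mexp; lia.
Qed.

Lemma modulusE :
  modulus = (\prod_(i < s) ps i ^ (e i - y i - Mexp q ps e y i) * xdeg)%N.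
Proof.
rewrite /xdeg -big_split /=; apply: eq_bigr => i _.
by rewrite -expnD subnK // leq_subr.
Qed.

(** * The factors as Frobenius orbit polynomials *)

Section Factors.

Variables (L : closedFieldType) (zeta : nat -> L).
Hypothesis zeta_compat : compatible_roots q zeta.

Lemma prim_zeta_modulus : modulus.-primitive_root (zeta modulus).
Proof.
apply: zeta_compat.1; rewrite coprime_sym.
by apply: coprime_prodr => i _; rewrite coprimeXr.
Qed.

(** Taking y and x as plain functions lets one definition serve both [Xn_factor] and, at y = 0,
    [Phi_factor]. *)
Definition reduced_factor (x : 'I_s -> nat) : {poly L} :=
  factor_shape q (zeta (\prod_(j < s) ps j ^ (e j - y j - Mexp q ps e y j))%N)
    (eta_pow eta x) (omega q ps e y) xdeg.

(* Both sides are monic of degree [omega * xdeg = period], and each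
   [zeta_m ^ (a q ^ u)] is a root of the left one. *)
Lemma reduced_factorE (x : 'I_s -> nat) :
  (forall i, x i < xnum q ps e y i)%N ->
  reduced_factor x =
    \prod_(u < period) ('X - ((zeta modulus ^ eta_pow eta x) ^+ (q ^ u))%:P).
Proof.
move=> bx; rewrite /reduced_factor factor_shape_prod.
set m' := (\prod_(j < s) _)%N; set a := eta_pow eta x; set w := omega q ps e y.
have xdeg_gt0 : (0 < xdeg)%N.
  by apply: prodn_gt0 => i; rewrite expn_gt0 prime_gt0.
have m'_gt0 : (0 < m')%N.
  by apply: prodn_gt0 => i; rewrite expn_gt0 prime_gt0.
have zeta_m' : zeta modulus ^+ xdeg = zeta m'.
  rewrite -(zeta_compat.2 m' modulus) ?modulusE ?dvdn_mulr ?mulKn //.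
  rewrite -modulusE coprime_sym.
  by apply: coprime_prodr => i _; rewrite coprimeXr.
have prim_m' : m'.-primitive_root (zeta m').
  apply: zeta_compat.1; rewrite coprime_sym.
  by apply: coprime_prodr => i _; rewrite coprimeXr.
set P := \prod_(u < w) _.
pose rs := [seq (zeta modulus ^ a) ^+ (q ^ u) | u : 'I_period].
have powE u : (zeta modulus ^ a) ^+ (q ^ u) = zeta modulus ^ (a * (q ^ u)%:Z).
  by rewrite exprnP exprz_exp.
have P_monic : P \is monic.
  by apply: monic_prod => u _; rewrite monicXnsubC.
have -> : \prod_(u < period) ('X - ((zeta modulus ^ a) ^+ (q ^ u))%:P) =
          \prod_(z <- rs) ('X - z%:P) by rewrite big_image.
rewrite [LHS](@all_roots_prod_XsubC _ P rs).
- by rewrite (monicP P_monic) scale1r.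
- rewrite size_prod => [|u _]; last by rewrite monic_neq0 // monicXnsubC.
  under eq_bigr do rewrite size_XnsubC //.
  rewrite sum_nat_const card_ord size_image card_ord period_omega -/w; lia.
- apply/allP => z /imageP[u _ ->]; rewrite powE.
  have w_gt0 : (0 < w)%N by apply: omega_gt0.
  (* The factor indexed by u modulo [omega] is the one that vanishes at this root. *)
  pose v := Ordinal (ltn_pmod u w_gt0).
  rewrite /root /P horner_prod (bigD1 v) //= mulf_eq0; apply/orP; left.
  rewrite !hornerE exprnP exprzAC -exprnP zeta_m' subr_eq0.
  rewrite (prim_exprz_eq prim_m') eqz_mod_dvd -mulrBr dvdz_mull // -eqz_mod_dvd.
  rewrite {1}(divn_eq u w) expnD mulnC expnM expnAC PoszM -modzMmr.
  suff -> : (((q ^ w) ^ (u %/ w))%N%:Z = 1 %[mod m'%:Z])%Z.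
    by rewrite modzMmr mulr1.
  rewrite PoszX -[1](expr1n _ (u %/ w)).
  apply: eqz_modX; apply/eqP.
  rewrite eqz_mod_dvd subzn ?expn_gt0 ?(ltnW q_gt1) //.
  by rewrite dvdzE !absz_nat reduced_modulus_dvd.
rewrite uniq_rootsE map_inj_in_uniq ?enum_uniq // => u v _ _ /eqP.
rewrite !powE (prim_exprz_eq prim_zeta_modulus) => E.
by apply/val_inj; have [] := box_inj bx bx (ltn_ord u) (ltn_ord v) E.
Qed.

(** Frobenius multiplies exponents of zeta_m by q; [box_inj] for a single x shows that the first
    [period] points of the orbit are distinct. *)
Lemma reduced_factor_irreducible (p k : nat) (F : finFieldType)
    (iota : {rmorphism F -> L}) (x : 'I_s -> nat) :
  prime p -> #|F| = (p ^ k)%N -> #|F| = q ->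
  (forall i, x i < xnum q ps e y i)%N ->
  exists r : {poly F},
    irreducible_poly r /\ reduced_factor x = map_poly iota r.
Proof.
move=> p_prime cardF cardFq bx; rewrite reduced_factorE // -cardFq.
apply: (irreducible_Frobenius_orbit _ p_prime cardF).
- exact: period_gt0.
- apply/eqP; rewrite cardFq exprnP exprz_exp (prim_exprz_eq prim_zeta_modulus).
  rewrite eqz_mod_dvd -[X in _ - X]mulr1 -mulrBr dvdz_mull //.
  rewrite -eqz_mod_dvd eqz_mod_modulus; apply/forallP => i.
  by rewrite PoszX fordP (biglcmn_sup i).
move=> u v ut vt /= /eqP; rewrite cardFq !exprnP !exprz_exp.
rewrite (prim_exprz_eq prim_zeta_modulus) => E.
by have [] := box_inj bx bx ut vt E.
Qed.

(** The pairs (x, u) give distinct primitive m-th roots by [box_inj], and by [xnum_period] there are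
    phi(m) of them, the degree of the cyclotomic polynomial. *)
Lemma cyclotomic_reduced_factors :
  cyclotomic (zeta modulus) modulus =
    \prod_(x : {dffun forall i : 'I_s, 'I_(xnum q ps e y i)})
       reduced_factor (fun i => x i).
Proof.
pose X := {dffun forall i : 'I_s, 'I_(xnum q ps e y i)}.
have bx (x : X) i : (x i < xnum q ps e y i)%N by [].
under eq_bigr => x _ do rewrite reduced_factorE //.
rewrite pair_big /=.
pose rt (xu : X * 'I_period) :=
  (zeta modulus ^ eta_pow eta (fun i => xu.1 i)) ^+ (q ^ xu.2).
pose rs := [seq rt xu | xu : X * 'I_period].
have -> : \prod_(xu : X * 'I_period) ('X - (rt xu)%:P) =
          \prod_(z <- rs) ('X - z%:P) by rewrite big_image.
have rtE xu : rt xu =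
    zeta modulus ^ (eta_pow eta (fun i => xu.1 i) * (q ^ xu.2)%:Z).
  by rewrite /rt exprnP exprz_exp.
rewrite [LHS](@all_roots_prod_XsubC _ _ rs).
- by rewrite (monicP (cyclotomic_monic _ _)) scale1r.
- rewrite size_cyclotomic size_image card_prod card_ord card_dep_ffun.
  rewrite foldrE big_image /= -xnum_period.
  by under [in RHS]eq_bigr do rewrite card_ord.
- apply/allP => z /imageP[xu _ ->].
  rewrite rtE (root_cyclotomic prim_zeta_modulus).
  apply: (prim_root_exprz prim_zeta_modulus).
  rewrite coprimezMl coprime_eta_pow coprimezE !absz_nat.
  by apply: coprime_prodr => i _; rewrite coprimeXl ?coprimeXr.
rewrite uniq_rootsE map_inj_in_uniq ?enum_uniq // => -[x u] [x' v] _ _ /eqP.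
rewrite !rtE (prim_exprz_eq prim_zeta_modulus) /= => E.
have [xx' uv] := box_inj (bx x) (bx x') (ltn_ord u) (ltn_ord v) E.
by rewrite (val_inj uv) (_ : x = x') //; apply/ffunP => i; apply/val_inj/xx'.
Qed.

End Factors.

End Tuples.

(** * Divisors of n indexed by the tuples y *)

Section Divisors.

Variables (s : nat) (ps : 'I_s -> nat).
Hypothesis ps_prime : forall i, prime (ps i).
Hypothesis ps_distinct : injective ps.

Lemma coprime_prod_pow (a : 'I_s -> nat) (r : pred 'I_s) (p : nat) :
  prime p -> (forall i, r i -> ps i != p) ->
  coprime p (\prod_(i < s | r i) ps i ^ a i).
Proof.
move=> p_prime ps_p; rewrite -big_filter; apply: coprime_prodr => i.
rewrite mem_filter => /andP[ri _].
by rewrite coprimeXr // prime_coprime // dvdn_prime2 // eq_sym ps_p.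
Qed.

Lemma logn_prod_pow (a : 'I_s -> nat) i :
  logn (ps i) (\prod_(j < s) ps j ^ a j) = a i.
Proof.
rewrite (bigD1 i) //= mulnC logn_Gauss ?pfactorK //.
by apply: coprime_prod_pow => // j ji; rewrite (inj_eq ps_distinct).
Qed.

Lemma prod_pow_logn (a : 'I_s -> nat) (d : nat) :
  (d %| \prod_(i < s) ps i ^ a i)%N ->
  d = (\prod_(i < s) ps i ^ logn (ps i) d)%N.
Proof.
have prod_gt0 b : (0 < \prod_(i < s) ps i ^ b i)%N.
  by apply: prodn_gt0 => i; rewrite expn_gt0 prime_gt0.
move=> dvd_d; have d_gt0 := dvdn_gt0 (prod_gt0 a) dvd_d.
apply: eqn_from_log => // p.
have [p_prime|p_nprime] := boolP (prime p); last first.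
  have logn0 m : logn p m = 0%N by rewrite lognE (negPf p_nprime).
  by rewrite !logn0.
case: (pickP (fun i => ps i == p)) => [i /eqP <-|ps_p].
  by rewrite logn_prod_pow.
have co_p b : coprime p (\prod_(i < s) ps i ^ b i).
  by apply: coprime_prod_pow => // i _; rewrite ps_p.
by rewrite !logn_coprime // (coprime_dvdr dvd_d).
Qed.

(** The tuple y records what is removed from the exponents of n: a divisor d corresponds to y_i =
    e_i - v_(p_i)(d). *)
Lemma perm_divisors_prod_pow (e : 'I_s -> nat) :
  perm_eq (divisors (\prod_(i < s) ps i ^ e i))
    [seq modulus ps e (fun i => y i)
       | y : {dffun forall i : 'I_s, 'I_(e i).+1}].
Proof.
have n_gt0 : (0 < \prod_(i < s) ps i ^ e i)%N.
  by apply: prodn_gt0 => i; rewrite expn_gt0 prime_gt0.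
apply: uniq_perm; first exact: divisors_uniq.
  rewrite map_inj_in_uniq ?enum_uniq // => y y' _ _ E.
  apply/ffunP => i; apply/val_inj => /=.
  have := congr1 (logn (ps i)) E; rewrite !logn_prod_pow.
  (* Truncated subtraction from e_i is injective only thanks to this bound. *)
  have le_e (z : 'I_(e i).+1) : (z <= e i)%N by rewrite -ltnS ltn_ord.
  by move=> Ei; rewrite -(subKn (le_e (y i))) Ei subKn.
move=> d; rewrite -dvdn_divisors //; apply/idP/imageP => [dvd_d|[y _ ->]].
  have le_logn i : (logn (ps i) d <= e i)%N.
    by rewrite -(logn_prod_pow e) dvdn_leq_log.
  exists [ffun i => inord (e i - logn (ps i) d)] => //.
  rewrite /modulus {1}(prod_pow_logn dvd_d); apply: eq_bigr => i _.
  by rewrite /ppart ffunE inordK ?ltnS ?leq_subr // subKn.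
apply: (big_ind2 dvdn) => // [a b c f ab cf|i _]; first exact: dvdn_mul.
by rewrite dvdn_exp2l ?leq_subr.
Qed.

End Divisors.

(** * From the factors of each cyclotomic polynomial to the two factorizations *)

Theorem theorem4p1 (p k q : nat) (F : finFieldType) (L : closedFieldType)
    (iota : {rmorphism F -> L}) (zeta : nat -> L)
    (s n : nat) (ps e : 'I_s -> nat) (eta : 'I_s -> int)
    (p_prime : prime p) (k_gt0 : (0 < k)%N) (q_def : q = (p ^ k)%N)
    (cardF : #|F| = q)
    (L_closure : algebraic_closure iota)
    (zeta_compat : compatible_roots q zeta)
    (ps_prime : forall i : 'I_s, prime (ps i))
    (ps_odd : forall i : 'I_s, odd (ps i))
    (ps_neq_p : forall i : 'I_s, ps i != p)
    (ps_distinct : injective ps)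
    (e_gt0 : forall i : 'I_s, (0 < e i)%N)
    (n_def : n = (\prod_(i < s) ps i ^ e i)%N)
    (eta_system : primitive_root_system ps e eta) :
  irreducible_factorization iota ('X^n - 1)
    (fun yx : Sigma q ps e => Xn_factor zeta eta yx) /\
  irreducible_factorization iota (cyclotomic (zeta n) n)
    (fun x : SigmaStar q ps e => Phi_factor zeta eta x).
Proof.
have q_gt1 : (1 < q)%N by rewrite q_def -(exp1n k) ltn_exp2r // prime_gt1.
have ps_coprime i : coprime q (ps i).
  by rewrite q_def coprimeXl // prime_coprime // dvdn_prime2 // eq_sym.
have cardFpk : #|F| = (p ^ k)%N by rewrite cardF.
have n_coprime : coprime n q.
  rewrite coprime_sym n_def; apply: coprime_prodr => i _.
  by rewrite coprimeXr.
have factorsE y := cyclotomic_reduced_factors y q_gt1 ps_prime ps_odd ps_coprime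
  ps_distinct eta_system zeta_compat.
have factor_irr y x := reduced_factor_irreducible q_gt1 ps_prime ps_odd
  ps_coprime ps_distinct eta_system zeta_compat iota p_prime cardFpk cardF
  (x := x) (y := y).
(* As e_j > 0, the exponent min(e_j, 1) is 1 at y = 0. *)
have omega0E : omega q ps e (fun=> 0%N) = omega0 q ps.
  by apply: eq_bigr => j _; rewrite subn0 (minn_idPr (e_gt0 j)) expn1.
have Mexp0E j : Mexp q ps e (fun=> 0%N) j = Mexp0 q ps e j.
  by rewrite /Mexp /Mexp0 omega0E subn0.
have Phi_factorE (x : SigmaStar q ps e) : Phi_factor zeta eta x =
    reduced_factor q ps e eta (fun=> 0%N) zeta (fun i => x i).
  rewrite /reduced_factor /xdeg omega0E.
  under [X in zeta X]eq_bigr do rewrite subn0 Mexp0E.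
  by under [X in factor_shape _ _ _ _ X]eq_bigr do rewrite Mexp0E.
split; split.
- rewrite (prod_cyclotomic (zeta_compat.1 n n_coprime)) {1}n_def.
  rewrite (perm_big _ (perm_divisors_prod_pow ps_prime ps_distinct e)) /=.
  rewrite big_image /= /Sigma.
  (* The product over the dependent pairs of [Sigma] is an iterated product, over y and then over
     x. *)
  rewrite -(sig_big_dep (fun=> true) (fun _ _ => true)
    (fun (y : {dffun forall i : 'I_s, 'I_(e i).+1})
         (x : {dffun forall i : 'I_s, 'I_(xnum q ps e (fun j => y j) i)}) =>
       reduced_factor q ps e eta (fun i => y i) zeta (fun i => x i))) /=.
  (* The decomposition of X^n - 1 uses the roots zeta_n^(n/d); compatibility turns them into
     zeta_d. *)
  apply: eq_bigr => y _; rewrite -factorsE zeta_compat.2 //.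
  rewrite n_def; apply: (big_ind2 dvdn) => // [a b c f ab cf|i _].
    exact: dvdn_mul.
  by rewrite dvdn_exp2l ?leq_subr.
- by move=> yx; apply: factor_irr => i; apply: ltn_ord.
(* Phi_n is the block y = 0, whose modulus is n itself. *)
- rewrite (_ : n = modulus ps e (fun=> 0%N)).
    by rewrite factorsE; apply: eq_bigr => x _; rewrite Phi_factorE.
  by rewrite n_def; apply: eq_bigr => i _; rewrite /ppart subn0.
by move=> x; rewrite Phi_factorE; apply: factor_irr => i; apply: ltn_ord.
Qed.
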